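(* Let $r\ge 1$ be an integer, let $c_1,c_2,\dots,c_r$ be real numbers, and let $(u_n)$ be the sequence defined by $u_0=1$, $u_j=0$ for $j<0$, and $$u_n=c_1u_{n-1}+c_2u_{n-2}+\cdots+c_ru_{n-r}\qquad (n\ge 1).$$ For $n\ge 1$ let $C=(C_{ij})_{1\le i,j\le n}$ be the $n\times n$ matrix with entries $$C_{ij}=\begin{cases}(-1)^{j-i}\,c_{j-i+1} & \text{if } 0\le j-i\le r-1,\\ 1 & \text{if } i=j+1,\\ 0 & \text{otherwise.}\end{cases}$$ Then $u_n=\det(C)$ for every $n\ge 1$.
   Context: The matrix $C$ is the upper Hessenberg Toeplitz matrix whose first row is $(c_1,-c_2,c_3,\dots,(-1)^{r+1}c_r,0,\dots,0)$ (truncated to its first $n$ entries if $n<r$), with $1$'s on the subdiagonal and $0$'s below the subdiagonal. *)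

(* Defs.v *)
From HB Require Import structures.
From mathcomp Require Import all_boot all_order all_algebra.
From mathcomp Require Import reals.
Set Implicit Arguments.
Unset Strict Implicit.
Unset Printing Implicit Defensive.

Import Order.TTheory GRing.Theory Num.Theory.
Local Open Scope ring_scope.

(* The coefficients c_1, ..., c_r are the values c 1, ..., c r; no other value
   of c is used.  Ordinals start at 0, but every entry depends only on
   differences of indices.  The subtraction j - i is truncated, whence the
   explicit test i <= j. *)
Definition toeplitz_hessenberg (R : realType) (r : nat) (c : nat -> R)
    (n : nat) : 'M[R]_n :=
  \matrix_(i < n, j < n)
    if (i <= j)%N && (j - i <= r - 1)%N then (-1) ^+ (j - i) * c (j - i + 1)%N
    else if i == (j + 1)%N :> nat then 1
    else 0.

(* Main.v *)
Require Import Defs.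
From HB Require Import structures.
From mathcomp Require Import all_boot all_order all_algebra.
From mathcomp Require Import reals.
From mathcomp Require Import zify ring.
Set Implicit Arguments.
Unset Strict Implicit.
Unset Printing Implicit Defensive.

Import Order.TTheory GRing.Theory Num.Theory.
Local Open Scope ring_scope.

(** The determinant is read off by Cramer's rule from one explicit vector.
    Index rows and columns from 0 to [m], where the size is [m.+1], and put
    [w_j = (-1)^(m-j) u_(m-j)].  In row [i] of [C w], the entries of [C] on and
    above the diagonal contribute [(-1)^(m-i) u_(m-i+1)] by the recurrence,
    while for [i > 0] the subdiagonal entry contributes [w_(i-1)], which is the
    opposite; hence [C w = (-1)^m u_(m+1) e_0] ([toeplitz_hessenberg_mul]).
    Multiplying by the adjugate of [C] and comparing the last coordinates,
    where [w_m = u_0 = 1], gives [det C = cofactor_(0,m) * (-1)^m u_(m+1)].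
    Deleting row 0 and the last column of [C] leaves an upper unitriangular
    matrix, so this cofactor is [(-1)^m] and the two signs cancel. *)

(** The recurrence over natural indices: the terms of negative index vanish,
    so that the sum may be cut off at the index of [u_0]. *)
Lemma recurrence_nat (R : pzRingType) (r : nat) (c : nat -> R) (u : int -> R)
    (uneg : forall j : int, j < 0 -> u j = 0)
    (urec : forall n : int, 1 <= n ->
      u n = \sum_(1 <= k < r.+1) c k * u (n - k%:Z)) (n : nat) :
  u n.+1%:Z = \sum_(0 <= l < n.+1 | (l < r)%N) c l.+1 * u (n - l)%N%:Z.
Proof.
rewrite urec // big_add1 /= (big_nat_widen _ _ (n.+1 + r)) ?leq_addl //=.
rewrite [RHS](big_nat_widen _ _ (n.+1 + r)) ?leq_addr //=.
rewrite [LHS](bigID (fun l => (l < n.+1)%N)) /= [X in _ + X]big1 ?addr0.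
  by apply: eq_bigr => l /andP[_ lt_ln]; congr (_ * u _); lia.
by move=> l /andP[_ ge_ln]; rewrite uneg ?mulr0 //; lia.
Qed.

(** The alternating signs of the vector absorb those of the band, so that each
    row becomes an instance of the recurrence. The subdiagonal entry supplies
    the value on its left-hand side with the opposite sign, in every row but
    the first one, which has no such entry. *)
Lemma toeplitz_hessenberg_mul (R : realType) (r : nat) (hr : (1 <= r)%N)
    (c : nat -> R) (u : int -> R)
    (uneg : forall j : int, j < 0 -> u j = 0)
    (urec : forall n : int, 1 <= n ->
      u n = \sum_(1 <= k < r.+1) c k * u (n - k%:Z)) (m : nat) (i : 'I_m.+1) :
  \sum_j toeplitz_hessenberg r c m.+1 i j * ((-1) ^+ (m - j) * u (m - j)%N%:Z)
    = if i == ord0 then (-1) ^+ m * u m.+1%:Z else 0.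
Proof.
have le_im : (i <= m)%N by rewrite -ltnS.
pose w j := (-1) ^+ (m - j) * u (m - j)%N%:Z.
pose a j := (-1) ^+ (j - i) * c (j - i + 1)%N.
have upper : \sum_(j < m.+1 | (i <= j)%N && (j - i < r)%N) a j * w j
    = (-1) ^+ (m - i) * u (m - i).+1%:Z.
  rewrite (recurrence_nat uneg urec) mulr_sumr.
  rewrite -(big_mkord (fun j => (i <= j)%N && (j - i < r)%N) (fun j => a j * w j)).
  rewrite (@big_cat_nat _ _ _ i) ?(leqW le_im) //=.
  rewrite big_nat_cond big_pred0 ?add0r; last by move=> j; lia.
  rewrite -{1}[nat_of_ord i]add0n big_addn subSn // big_nat_cond.
  rewrite [RHS]big_nat_cond; apply: eq_big => l; first by rewrite addnK leq_addl.
  move=> /andP[/andP[_ lt_l] _]; rewrite /a /w addnK addn1.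
  have -> : (m - (l + i) = m - i - l)%N by lia.
  have -> : ((-1) ^+ (m - i) = (-1) ^+ l * (-1) ^+ (m - i - l) :> R).
    by rewrite -exprD subnKC //; lia.
  by ring.
rewrite (bigID (fun j : 'I_m.+1 => (i <= j)%N && (j - i < r)%N)) /=.
rewrite (eq_bigr (fun j : 'I_m.+1 => a j * w j)); last first.
  move=> j Hj; rewrite mxE ifT //; lia.
rewrite upper.
(* Off the upper band only the subdiagonal entry, in column i - 1, is left. *)
case: eqP => [-> | /eqP i_neq0].
  rewrite subn0 big1 ?addr0 // => j Hj.
  by rewrite mxE ifF ?ifF ?mul0r //=; move: Hj => /=; lia.
have i_gt0 : (0 < i)%N by rewrite lt0n.
have lt_pred : (i.-1 < m.+1)%N by lia.
rewrite (bigD1 (Ordinal lt_pred)) /=; last by lia.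
rewrite [X in _ + (_ + X)]big1 ?addr0; last first.
  move=> j /andP[Hj]; rewrite -val_eqE /= => neq_j.
  by rewrite mxE ifF ?ifF ?mul0r //=; lia.
rewrite mxE /= ifF ?ifT; [|lia|lia].
have -> : (m - i.-1 = (m - i).+1)%N by lia.
by rewrite exprS; ring.
Qed.

(** Deleting the first row and the last column moves the subdiagonal of ones
    onto the diagonal, so the minor is that of an upper unitriangular matrix. *)
Lemma cofactor_toeplitz_hessenberg (R : realType) (r : nat) (c : nat -> R)
    (m : nat) :
  cofactor (toeplitz_hessenberg r c m.+1) ord0 ord_max = (-1) ^+ m.
Proof.
rewrite /cofactor /= add0n -det_tr det_trig.
  rewrite big1 ?mulr1 // => i _; rewrite !mxE /= /bump.
  rewrite [(m <= i)%N]leqNgt ltn_ord /=.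
  by rewrite ifF ?ifT; [| lia | lia].
apply/is_trig_mxP => i j lt_ij; rewrite !mxE /= /bump.
rewrite [(m <= i)%N]leqNgt ltn_ord /=.
by rewrite ifF ?ifF; [| lia | lia].
Qed.

Theorem theorem3p1 (R : realType) (r : nat) (hr : (1 <= r)%N) (c : nat -> R)
    (u : int -> R)
    (u0 : u 0 = 1)
    (uneg : forall j : int, j < 0 -> u j = 0)
    (urec : forall n : int, 1 <= n ->
      u n = \sum_(1 <= k < r.+1) c k * u (n - k%:Z))
    (n : nat) (hn : (1 <= n)%N) :
  u n%:Z = \det (toeplitz_hessenberg r c n).
Proof.
case: n hn => // m _; set C := toeplitz_hessenberg r c m.+1.
pose w : 'cV[R]_m.+1 := \col_j ((-1) ^+ (m - j) * u (m - j)%N%:Z).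
have Cw i : (C *m w) i 0 = if i == ord0 then (-1) ^+ m * u m.+1%:Z else 0.
  rewrite mxE -(toeplitz_hessenberg_mul hr uneg urec).
  by apply: eq_bigr => j _; rewrite [w _ _]mxE.
(* The last coordinate is the one in which w equals u 0 = 1. *)
have /matrixP/(_ ord_max 0) : \adj C *m (C *m w) = \det C *: w.
  by rewrite mulmxA mul_adj_mx mul_scalar_mx.
rewrite [RHS]mxE [w _ _]mxE /= subnn u0 !mulr1 => <-.
rewrite mxE (bigD1 ord0) //= big1 ?addr0; last first.
  by move=> i /negbTE i_neq0; rewrite Cw i_neq0 mulr0.
rewrite Cw eqxx mxE cofactor_toeplitz_hessenberg mulrA -exprD addnn.
by rewrite -signr_odd odd_double mul1r.
Qed.
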